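(* There exist a prime $p$, a countable field $F$ of characteristic $p$, and a finitely generated, graded, infinite dimensional nil associative $F$-algebra $R$ whose adjoint group $R^\circ$ is generated by a set of elements of bounded torsion; that is, there exist a positive integer $N$ and a subset $S\subseteq R^\circ$ generating $R^\circ$ as a group such that every element of $S$ has finite order at most $N$.
   Context: Algebras are associative and not assumed to have a unit. An algebra $R$ is nil if for every $r\in R$ there is $n\geq 1$ with $r^n=0$. For a nil algebra $R$, the adjoint group $R^\circ$ is the group with underlying set $R$ and multiplication $r\circ s=r+s+rs$ (its identity element is $0$); it can be thought of as $\{1+r\mid r\in R\}$ with the usual multiplication $(1+r)(1+s)=1+r+s+rs$. Finitely generated means finitely generated as an $F$-algebra. Graded means graded by the positive integers: $R=\bigoplus_{n\geq 1}R(n)$ as $F$-vector spaces, with $R(i)R(j)\subseteq R(i+j)$ for all $i,j\geq 1$. *)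

(* Defs.v *)
From HB Require Import structures.
From mathcomp Require Import all_boot all_order all_algebra.

Set Implicit Arguments.
Unset Strict Implicit.
Unset Printing Implicit Defensive.

Import GRing.Theory.
Local Open Scope ring_scope.

HB.mixin Record Lmodule_isNUAlgebra (F : fieldType) R of GRing.Lmodule F R := {
  numul : R -> R -> R;
  numulA : associative numul;
  numulDl : left_distributive numul +%R;
  numulDr : right_distributive numul +%R;
  numulZl : forall (a : F) (x y : R), numul (a *: x) y = a *: numul x y;
  numulZr : forall (a : F) (x y : R), numul x (a *: y) = a *: numul x y
}.

(* Associative F-algebras without a unit assumption; the algebra hierarchy of
   ssralg is unital throughout. *)
#[short(type="nuAlgType")]
HB.structure Definition NUAlgebra (F : fieldType) :=
  {R of GRing.Lmodule F R & Lmodule_isNUAlgebra F R}.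

Notation "x ** y" := (numul x y) (at level 40, left associativity) : ring_scope.

(* x^n, for n >= 1 only: there is no x^0, and the value at n = 0 is junk. *)
Definition nuexp (F : fieldType) (R : nuAlgType F) (x : R) (n : nat) : R :=
  iter n.-1 (numul x) x.

Definition nil_algebra (F : fieldType) (R : nuAlgType F) : Prop :=
  forall x : R, exists n : nat, (0 < n)%N /\ nuexp x n = 0.

(* Subsets are boolean predicates, as in the closure notions of the library;
   classically this is no restriction. *)
Definition subalgebra_closed (F : fieldType) (R : nuAlgType F) (A : {pred R}) :
    Prop :=
  submod_closed A /\ {in A &, forall x y : R, x ** y \in A}.

Definition finitely_generated (F : fieldType) (R : nuAlgType F) : Prop :=
  exists s : seq R, forall A : {pred R},
    subalgebra_closed A -> {subset s <= A} -> forall x : R, x \in A.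

Definition infinite_dimensional (F : fieldType) (R : lmodType F) : Prop :=
  ~ exists (n : nat) (e : 'I_n -> R),
      forall x : R, exists c : 'I_n -> F, x = \sum_i c i *: e i.

(* R is the internal direct sum of the V n, n >= 1: the second and third clauses
   are existence and uniqueness of finite decompositions. V 0 plays no role. *)
Definition grading (F : fieldType) (R : nuAlgType F) (V : nat -> {pred R}) :
    Prop :=
  [/\ forall n : nat, (0 < n)%N -> submod_closed (V n),
      forall x : R, exists (m : nat) (c : nat -> R),
        (forall n, (0 < n)%N -> c n \in V n) /\ x = \sum_(1 <= n < m) c n,
      forall (m : nat) (c : nat -> R),
        (forall n, (0 < n)%N -> c n \in V n) -> \sum_(1 <= n < m) c n = 0 ->
        forall n, (0 < n < m)%N -> c n = 0
    & forall i j : nat, (0 < i)%N -> (0 < j)%N ->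
        {in V i & V j, forall x y : R, x ** y \in V (i + j)%N}].

Definition graded (F : fieldType) (R : nuAlgType F) : Prop :=
  exists V : nat -> {pred R}, grading V.

Section NUAlgebraTheory.
Variables (F : fieldType) (R : nuAlgType F).
Implicit Types x y : R.

Lemma nu0mul x : 0 ** x = 0.
Proof. by apply: (addIr (0 ** x)); rewrite -numulDl !add0r. Qed.

Lemma numul0 x : x ** 0 = 0.
Proof. by apply: (addIr (x ** 0)); rewrite -numulDr !add0r. Qed.

Lemma nuNmul x y : (- x) ** y = - (x ** y).
Proof. by rewrite -scaleN1r numulZl scaleN1r. Qed.

Lemma numulN x y : x ** (- y) = - (x ** y).
Proof. by rewrite -scaleN1r numulZr scaleN1r. Qed.

Lemma nuexpS x n : (0 < n)%N -> nuexp x n.+1 = x ** nuexp x n.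
Proof. by case: n. Qed.

Lemma nuexpSr x n : (0 < n)%N -> nuexp x n.+1 = nuexp x n ** x.
Proof.
case: n => // n _; elim: n => // n IHn.
by rewrite nuexpS // [in LHS]IHn numulA -nuexpS //.
Qed.

Lemma numul_sumr x (m n : nat) (f : nat -> R) :
  x ** (\sum_(m <= i < n) f i) = \sum_(m <= i < n) x ** f i.
Proof. by apply: (big_morph (numul x)); [exact: numulDr | exact: numul0]. Qed.

Lemma numul_suml x (m n : nat) (f : nat -> R) :
  (\sum_(m <= i < n) f i) ** x = \sum_(m <= i < n) f i ** x.
Proof.
apply: (big_morph (numul^~ x)) => [y z|]; [exact: numulDl | exact: nu0mul].
Qed.

Hypothesis nilR : nil_algebra R.

Lemma nil_index x : exists n, (0 < n)%N && (nuexp x n == 0).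
Proof. by have [n [n_gt0 /eqP xn0]] := nilR x; exists n; rewrite n_gt0. Qed.

Definition circ x y : R := x + y + x ** y.

(* (1 + x)^-1 - 1 = \sum_(n >= 1) (- x)^n *)
Definition circ_inv x : R :=
  \sum_(1 <= n < ex_minn (nil_index (- x))) nuexp (- x) n.

Lemma circA : associative circ.
Proof.
move=> x y z; rewrite /circ !numulDl !numulDr numulA !addrA.
by rewrite [LHS](ACl (1*2*5*3*6*4*7)%AC).
Qed.

Lemma circ0r : left_id 0 circ.
Proof. by move=> x; rewrite /circ nu0mul add0r addr0. Qed.

Lemma circr0 : right_id 0 circ.
Proof. by move=> x; rewrite /circ numul0 !addr0. Qed.

Lemma circ_sum x n : (0 < n)%N -> nuexp x n = 0 ->
  \sum_(1 <= i < n) nuexp x i.+1 = \sum_(1 <= i < n) nuexp x i - x.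
Proof.
move=> n_gt0 xn0; apply/eqP; rewrite eq_sym subr_eq addrC; apply/eqP.
have -> : \sum_(1 <= i < n) nuexp x i = \sum_(1 <= i < n.+1) nuexp x i.
  by rewrite big_nat_recr //= xn0 addr0.
by rewrite big_nat_recl.
Qed.

Lemma circVr : left_inverse 0 circ_inv circ.
Proof.
move=> x; rewrite -[x]opprK /circ /circ_inv; move: (- x) => y; rewrite opprK.
case: ex_minnP => n /andP[n_gt0 /eqP xn0] _.
rewrite numulN numul_suml.
have -> : \sum_(1 <= i < n) nuexp y i ** y = \sum_(1 <= i < n) nuexp y i.+1.
  by apply: eq_big_nat => i /andP[i_gt0 _]; rewrite nuexpSr.
by rewrite circ_sum // subrr.
Qed.

Lemma circrV : right_inverse 0 circ_inv circ.
Proof.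
move=> x; rewrite -[x]opprK /circ /circ_inv; move: (- x) => y; rewrite opprK.
case: ex_minnP => n /andP[n_gt0 /eqP xn0] _.
rewrite nuNmul numul_sumr.
have -> : \sum_(1 <= i < n) y ** nuexp y i = \sum_(1 <= i < n) nuexp y i.+1.
  by apply: eq_big_nat => i /andP[i_gt0 _]; rewrite nuexpS.
by rewrite circ_sum // (addrC (- y)) subrr.
Qed.

End NUAlgebraTheory.

(* The adjoint group lives on an alias of R, so that its group law is not
   confused with the operations of R. *)
Definition adjoint (F : fieldType) (R : nuAlgType F) (nilR : nil_algebra R) :
  Type := R.

HB.instance Definition _ (F : fieldType) (R : nuAlgType F)
    (nilR : nil_algebra R) :=
  Choice.on (adjoint nilR).

HB.instance Definition _ (F : fieldType) (R : nuAlgType F)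
    (nilR : nil_algebra R) :=
  isGroup.Build (adjoint nilR)
    (@circA F R) (@circ0r F R) (@circr0 F R) (circVr nilR) (circrV nilR).

Lemma adjointM (F : fieldType) (R : nuAlgType F) (nilR : nil_algebra R)
    (x y : adjoint nilR) :
  (x * y)%g = (x : R) + (y : R) + (x : R) ** (y : R) :> R.
Proof. by []. Qed.

Lemma adjoint1 (F : fieldType) (R : nuAlgType F) (nilR : nil_algebra R) :
  (1%g : adjoint nilR) = 0 :> R.
Proof. by []. Qed.

Definition generates_group (G : groupType) (S : {pred G}) : Prop :=
  forall H : {pred G}, group_closed H -> {subset S <= H} ->
    forall x : G, x \in H.

Definition has_order (G : groupType) (x : G) (n : nat) : Prop :=
  [/\ (0 < n)%N, (x ^+ n = 1)%g
    & forall m : nat, (0 < m < n)%N -> (x ^+ m <> 1)%g].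

(* Main.v *)
Require Import Defs.
From HB Require Import structures.
From mathcomp Require Import all_boot all_order all_algebra.
From mathcomp Require Import boolp functions zify.

Set Implicit Arguments.
Unset Strict Implicit.
Unset Printing Implicit Defensive.

Import GRing.Theory.
Local Open Scope ring_scope.

(** Let A be the free algebra without unit on four letters over the field with
two elements, and R = A / I for a homogeneous ideal I with three families of
generators, chosen as follows.

- w^8 for every nonempty word w.  In characteristic 2 one has
  (1 + r)^8 = 1 + r^8, so each 1 + w has order dividing 8 in the adjoint group.

- A is countable; let a_k be an enumeration of it.  All the homogeneous
  components of a_k^(k+9) are put in I.  This makes R nil.

- Modulo degree > M, every 1 + a is a finite product of factors 1 + w with w a
  word: a product that is correct up to degree M is corrected in degree M + 1
  by extra factors 1 + v, one for each word v of length M + 1 in the error, and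
  these factors change nothing else in degrees <= M + 1 ([factors_vanish]).
  With M = k + 8, the homogeneous components of the difference between 1 + a_k
  and such a product are put in I, so that in R the element 1 + a_k is a finite
  product of elements of order dividing 8 ([word_gen_generates]).

The last two families consist of elements of A of degree > k + 8 at step k, so
they contribute at most 2 (j - 8) generators in degree j, and the first family
contributes 4^(j/8) generators if 8 divides j.  This is sparse enough for the
argument of Golod and Shafarevich, which shows that no homogeneous component of
R vanishes ([annih_deg_nontrivial]).

The whole construction is carried out on the dual side.  Instead of I one uses
the space of the linear functionals on A, that is, of the functions on words,
which vanish on I: it is described by an explicit condition ([annih]), and it
determines R as the space of the functions that polynomials induce on it
([quo]).  As the field is finite, the functionals supported in degree n form a
finite set, with c(n) elements say, and the Golod-Shafarevich inequality becomes
a statement on cardinals: a function on words of length n + 1 is a functional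
killing I as soon as its four left translates by a letter kill I, and it
satisfies one more linear condition for each generator f of degree j, which
says that its contraction with f, a functional on degree n + 1 - j that already
kills I, is zero.  Hence c(n)^4 is at most the product of c(n + 1) and of
c(n + 1 - j) over all generators, from which c(n)^2 <= c(n + 1) follows. *)

(** * Noncommutative polynomials over the field with two elements *)

Lemma F2_cases (c : 'F_2) : c = 0 \/ c = 1.
Proof. by case: c => [[|[|//]] ?]; [left|right]; apply: val_inj. Qed.

Lemma F2_addxx (c : 'F_2) : c + c = 0.
Proof. exact: (addrr_pchar2 (pchar_Fp (isT : prime 2))). Qed.

Section Words.
Variable X : finType.
Implicit Types (phi psi : seq X -> 'F_2) (a b t : seq (seq X)).

(** A list of words stands for the sum of its entries, so two lists are the same
polynomial if and only if they have the same value under every functional [phi]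
on words; polynomials are only ever compared in this way. *)
Definition ev phi a : 'F_2 := \sum_(w <- a) phi w.

Lemma eq_ev phi psi a : {in a, phi =1 psi} -> ev phi a = ev psi a.
Proof. by move=> eq_fg; apply: eq_big_seq. Qed.

Lemma ev0 a : ev (fun=> 0) a = 0.
Proof. exact: big1. Qed.

Lemma ev_eq0 phi a : {in a, forall w, phi w = 0} -> ev phi a = 0.
Proof. by move=> phi0; rewrite (eq_ev (psi := fun=> 0)) ?ev0. Qed.

Lemma evB phi psi a : ev (fun w => phi w - psi w) a = ev phi a - ev psi a.
Proof. exact: sumrB. Qed.

Lemma ev_nil phi : ev phi [::] = 0.
Proof. exact: big_nil. Qed.

Lemma ev_cons phi w a : ev phi (w :: a) = phi w + ev phi a.
Proof. exact: big_cons. Qed.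

Lemma ev1 phi w : ev phi [:: w] = phi w.
Proof. exact: big_seq1. Qed.

Lemma ev_cat phi a b : ev phi (a ++ b) = ev phi a + ev phi b.
Proof. exact: big_cat. Qed.

Definition mulp a b : seq (seq X) := [seq u ++ v | u <- a, v <- b].

Lemma ev_mulpl phi a b :
  ev phi (mulp a b) = \sum_(u <- a) ev (fun v => phi (u ++ v)) b.
Proof. exact: big_allpairs_dep. Qed.

Lemma ev_mulpr phi a b :
  ev phi (mulp a b) = \sum_(v <- b) ev (fun u => phi (u ++ v)) a.
Proof. by rewrite ev_mulpl exchange_big. Qed.

Lemma ev_mulpA phi a b c :
  ev phi (mulp a (mulp b c)) = ev phi (mulp (mulp a b) c).
Proof.
rewrite !ev_mulpl [RHS]big_allpairs_dep /=.
apply: eq_bigr => u _; rewrite ev_mulpl; apply: eq_bigr => v _.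
by apply: eq_bigr => w _; rewrite catA.
Qed.

Lemma mulp_catl a1 a2 b : mulp (a1 ++ a2) b = mulp a1 b ++ mulp a2 b.
Proof. by rewrite /mulp map_cat flatten_cat. Qed.

(** Polynomials without constant term, in the strong sense that the empty word
does not occur even in pairs that cancel. *)
Definition posp a := [::] \notin a.

Lemma pospP a : reflect (forall w, w \in a -> w != [::]) (posp a).
Proof.
apply: (iffP idP) => [pa w wa|pa]; first by apply: contraNneq pa => <-.
by apply/negP => /pa.
Qed.

Lemma posp_cons w a : posp (w :: a) = (w != [::]) && posp a.
Proof. by rewrite /posp inE negb_or eq_sym. Qed.

Lemma posp_cat a b : posp (a ++ b) = posp a && posp b.
Proof. by rewrite /posp mem_cat negb_or. Qed.

Lemma posp_mul a b : posp a -> posp (mulp a b).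
Proof.
move=> pa; apply/pospP => _ /allpairsPdep[u [v [ua vb ->]]].
by case: u ua => // ua; rewrite (negPf pa) in ua.
Qed.

Definition homog n a := all (fun w => size w == n) a.

Lemma homog_posp n a : (0 < n)%N -> homog n a -> posp a.
Proof.
by move=> n0 /allP ha; apply/pospP => w /ha; case: w n0 => //= /[swap] /eqP <-.
Qed.

Definition part n a := [seq w <- a | size w == n].

Lemma part_homog n a : homog n (part n a).
Proof. by apply/allP => w; rewrite mem_filter => /andP[]. Qed.

Lemma posp_part n a : posp a -> posp (part n a).
Proof. by rewrite /posp mem_filter negb_and orbC => ->. Qed.

Lemma sum_part phi a m : (forall w, w \in a -> (0 < size w < m)%N) ->
  ev phi a = \sum_(1 <= n < m) ev phi (part n a).
Proof.
move=> sa; rewrite /ev.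
under [RHS]eq_bigr do rewrite /part big_filter big_mkcond.
rewrite exchange_big /=; apply: eq_big_seq => w /sa sw; rewrite -big_mkcond /=.
under eq_bigl do rewrite eq_sym.
by rewrite big_nat1_eq sw.
Qed.

Lemma size_lt_bound a w :
  w \in a -> (size w < (\max_(u <- a) size u).+1)%N.
Proof. by move=> wa; rewrite ltnS (leq_bigmax_seq (F := size)). Qed.

Definition trunc (P : pred nat) phi (w : seq X) : 'F_2 :=
  if P (size w) then phi w else 0.

Lemma ev_part n phi a : ev phi (part n a) = ev (trunc (pred1 n) phi) a.
Proof. by rewrite /ev big_filter big_mkcond. Qed.

Lemma ev_trunc_homog n phi a :
  homog n a -> ev (trunc (pred1 n) phi) a = ev phi a.
Proof.
by move=> /allP ha; apply: eq_ev => w /ha /= sw; rewrite /trunc /= sw.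
Qed.

Lemma ev_trunc_other n m phi a :
  homog n a -> n != m -> ev (trunc (pred1 m) phi) a = 0.
Proof.
move=> /allP ha nm; apply: ev_eq0 => w /ha /eqP sw.
by rewrite /trunc /= sw (negPf nm).
Qed.

End Words.

(** * Functionals that annihilate an ideal *)

Section Annihilator.
Variables (X : finType) (rel : nat -> seq (seq (seq X))).
Implicit Types (phi psi : seq X -> 'F_2).

(** The functionals that vanish on the two-sided ideal generated by the
polynomials in the lists [rel j]; the index [j] is meant to be the degree. *)
Definition annih phi : Prop :=
  forall j f, f \in rel j ->
  forall u v, ev (fun w => phi (u ++ w ++ v)) f = 0.

Lemma eq_annih phi psi : phi =1 psi -> annih phi -> annih psi.
Proof.
move=> eq_fg Wphi j f fr u v.
by rewrite -[RHS](Wphi j f fr u v); apply: eq_ev => w _.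
Qed.

Lemma annih0 : annih (fun=> 0).
Proof. by move=> *; apply: ev0. Qed.

Lemma annihB phi psi :
  annih phi -> annih psi -> annih (fun w => phi w - psi w).
Proof.
by move=> Wphi Wpsi j f fr u v; rewrite evB (Wphi _ _ fr) (Wpsi _ _ fr) subr0.
Qed.

Lemma annih_shiftl phi p : annih phi -> annih (fun w => phi (p ++ w)).
Proof.
move=> Wphi j f fr u v; rewrite -[RHS](Wphi j f fr (p ++ u) v).
by apply: eq_ev => w _; rewrite catA.
Qed.

Lemma annih_shiftr phi q : annih phi -> annih (fun w => phi (w ++ q)).
Proof.
move=> Wphi j f fr u v; rewrite -[RHS](Wphi j f fr u (v ++ q)).
by apply: eq_ev => w _; rewrite -!catA.
Qed.

Hypothesis rel_homog : forall j f, f \in rel j -> homog j f.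

(** This is where homogeneity of the relations matters: it makes the ideal, and
hence the quotient, graded. *)
Lemma annih_trunc P phi : annih phi -> annih (trunc P phi).
Proof.
move=> Wphi j f fr u v; have /allP hf := rel_homog fr.
pose b := P (size u + j + size v)%N.
rewrite (eq_ev (psi := fun w => if b then phi (u ++ w ++ v) else 0)).
  by case: b; [apply: Wphi fr _ _ | apply: ev0].
by move=> w /hf /eqP sw; rewrite /trunc !size_cat sw addnA.
Qed.

(** * The Golod-Shafarevich count *)

Local Notation V n := {ffun n.-tuple X -> 'F_2}.

(** Functions on words of length [n] form a finite type; [ext] extends them by
zero to all words, so that concatenation never has to be typed with lengths. *)
Definition ext n (v : V n) (w : seq X) : 'F_2 :=
  if insub w is Some t then v t else 0.

Definition restr n phi : V n := [ffun t => phi (tval t)].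

Lemma extE n (v : V n) (t : n.-tuple X) : ext v t = v t.
Proof. by rewrite /ext valK. Qed.

Lemma ext_out n (v : V n) w : size w != n -> ext v w = 0.
Proof. by move=> sw; rewrite /ext insubF //; apply: negbTE. Qed.

Lemma ext0 n w : ext (0 : V n) w = 0.
Proof. by rewrite /ext; case: insub => // t; rewrite ffunE. Qed.

Lemma extB n (u v : V n) w : ext (u - v) w = ext u w - ext v w.
Proof. by rewrite /ext; case: insubP => [t _ _|_]; rewrite ?ffunE ?subr0. Qed.

Lemma restrK n phi : (forall w, size w != n -> phi w = 0) ->
  ext (restr n phi) =1 phi.
Proof.
move=> supp w; case: (eqVneq (size w) n) => [/eqP sw|sw]; last first.
  by rewrite ext_out // supp.
by have -> : w = Tuple sw by []; rewrite extE ffunE.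
Qed.

Definition annih_deg n : {set V n} := [set v | `[< annih (ext v) >]].

Lemma annih_deg_restr n phi : (forall w, size w != n -> phi w = 0) ->
  (restr n phi \in annih_deg n) <-> annih phi.
Proof.
move=> supp; rewrite inE; split=> [/asboolP|Wphi].
  by apply: eq_annih; apply: restrK.
by apply/asboolP; apply: eq_annih Wphi => w; rewrite restrK.
Qed.

(** Subtracting a fixed element of a fibre of a homomorphism [h] maps that fibre
injectively to the kernel, so no fibre is larger than the kernel. *)
Lemma card_kernel (U Q : finType) (ker : {set U}) (h : U -> Q)
    (sub : U -> U -> U) (A : {set U}) (B : {set Q}) :
  (forall u, injective (sub^~ u)) ->
  {in A &, forall u v, h u = h v -> sub u v \in ker} ->
  {in A, forall u, h u \in B} -> (#|A| <= #|ker| * #|B|)%N.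
Proof.
move=> sub_inj ker_sub hAB.
rewrite -sum1_card (partition_big h (mem B)) //= mulnC -sum_nat_const.
apply: leq_sum => q _.
have [/existsP[v /andP[vA /eqP hv]]|none] :=
  boolP [exists v, (v \in A) && (h v == q)]; last first.
  rewrite big_pred0 // => u; apply: contraNF none => uA.
  by apply/existsP; exists u.
rewrite sum1dep_card -(card_imset _ (sub_inj v)); apply: subset_leq_card.
apply/subsetP => _ /imsetP[u /setIdP[uA /eqP hu] ->].
by apply: ker_sub; rewrite // hu hv.
Qed.

(** An approximation to [annih_deg n.+1]: the functionals that kill the part of
the ideal spanned by the products of a letter and an element of the ideal.  The
ideal is spanned by this part and by the products [f v] of a relation and a
word, which the contractions below take care of. *)
Definition preannih n : {set V n.+1} :=
  [set v | [forall x, restr n (fun w => ext v (x :: w)) \in annih_deg n]].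

Lemma preannihP n (v : V n.+1) :
  reflect (forall p, p != [::] -> annih (fun w => ext v (p ++ w)))
          (v \in preannih n).
Proof.
rewrite inE; apply: (iffP forallP) => [vD [//|x p] _|vD x]; last first.
  apply/annih_deg_restr; last exact: (vD [:: x] isT).
  by move=> w sw; rewrite ext_out.
apply: (annih_shiftl (phi := fun w => ext v (x :: w))).
by apply: (annih_deg_restr _).1 (vD x) => w sw; rewrite ext_out.
Qed.

Lemma preannihB n (u v : V n.+1) :
  u \in preannih n -> v \in preannih n -> u - v \in preannih n.
Proof.
move=> /preannihP uD /preannihP vD; apply/preannihP => p p0.
by apply: eq_annih (annihB (uD p p0) (vD p p0)) => w; rewrite extB.
Qed.

(** The left translates by the letters can be prescribed independently. *)
Lemma card_preannih n : (#|annih_deg n| ^ #|X| <= #|preannih n|)%N.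
Proof.
pose phi (F : {ffun X -> V n}) w := if w is x :: u then ext (F x) u else 0.
have phi_supp F w : size w != n.+1 -> phi F w = 0.
  by case: w => // x u; rewrite /= eqSS; apply: ext_out.
pose g F := restr n.+1 (phi F).
have gE F x : restr n (fun w => ext (g F) (x :: w)) = F x.
  apply/ffunP => t; rewrite ffunE restrK; last exact: phi_supp.
  exact: extE.
have g_inj : injective g.
  by move=> F G eqFG; apply/ffunP => x; rewrite -[LHS]gE eqFG gE.
rewrite -card_ffun_on -(card_imset _ g_inj); apply: subset_leq_card.
apply/subsetP => _ /imsetP[F /ffun_onP FW ->].
by rewrite inE; apply/forallP => x; rewrite gE.
Qed.

Definition contr (f : seq (seq X)) phi (v : seq X) : 'F_2 :=
  ev (fun w => phi (w ++ v)) f.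

Lemma contr_supp n j f (v : V n.+1) w : homog j f -> (j <= n.+1)%N ->
  size w != (n.+1 - j)%N -> contr f (ext v) w = 0.
Proof.
move=> /allP hf le_j sw; apply: ev_eq0 => u /hf /eqP su.
rewrite ext_out // size_cat su; lia.
Qed.

Lemma restr_contrB n m f (u v : V n) :
  restr m (contr f (ext (u - v)))
  = restr m (contr f (ext u)) - restr m (contr f (ext v)).
Proof.
apply/ffunP => t; rewrite !ffunE /contr -evB.
by apply: eq_ev => x _; apply: extB.
Qed.

(** The reason why a relation of degree [j] costs a factor
[#|annih_deg (n.+1 - j)|] only, and not the number of all functions of that
degree: contraction puts the nonempty words of [f] on the left, where they turn
an element of [preannih n] into an annihilating functional. *)
Lemma annih_contr n j f (v : V n.+1) : v \in preannih n -> homog j f ->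
  (0 < j)%N -> annih (contr f (ext v)).
Proof.
move=> /preannihP vD /allP hf j_gt0 i g gr u s.
rewrite /ev /contr /ev exchange_big /= big1_seq // => w /andP[_ /hf /eqP sw].
have w0 : w != [::] by case: w sw j_gt0 => //= <-.
by rewrite -[RHS](vD w w0 i g gr u s).
Qed.

Definition rels_upto n : seq (nat * seq (seq X)) :=
  [seq (j, f) | j <- iota 1 n, f <- rel j].

Definition killed n (L : seq (nat * seq (seq X))) : {set V n.+1} :=
  [set v in preannih n
  | all (fun jf => restr (n.+1 - jf.1) (contr jf.2 (ext v)) == 0) L].

Lemma card_killed n L : {subset L <= rels_upto n.+1} ->
  (#|annih_deg n| ^ #|X|
     <= #|killed n L| * \prod_(jf <- L) #|annih_deg (n.+1 - jf.1)|)%N.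
Proof.
elim: L => [_|[j f] L IHL sL].
  rewrite big_nil muln1; apply: leq_trans (card_preannih n) _.
  by apply/subset_leq_card/subsetP => v vD; rewrite inE vD.
have /allpairsPdep[j' [f' [jI fr [? ?]]]] := sL _ (mem_head _ _).
subst j' f'; move: jI; rewrite mem_iota => /andP[j_gt0 lt_j].
apply: leq_trans (IHL _) _; first by move=> x xL; rewrite sL // inE xL orbT.
rewrite big_cons mulnA leq_mul2r; apply/orP; right.
apply: (card_kernel (sub := fun u v => u - v)
  (h := fun v => restr (n.+1 - j) (contr f (ext v)))) => [u x y|u v|u].
- exact: addIr.
- move=> /setIdP[uD /allP uL] /setIdP[vD /allP vL] /= huv.
  rewrite inE preannihB //= restr_contrB huv subrr eqxx /=.
  apply/allP => x xL.
  by rewrite restr_contrB (eqP (uL _ xL)) (eqP (vL _ xL)) subr0.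
- move=> /setIdP[uD _]; apply/annih_deg_restr.
    by move=> w; apply: contr_supp; [exact: rel_homog | lia].
  by apply: annih_contr uD (rel_homog fr) j_gt0.
Qed.

(* A relation of degree 0 would be the unit of the free algebra. *)
Hypothesis rel0 : rel 0 = [::].

Lemma killed_annih_deg n : killed n (rels_upto n.+1) \subset annih_deg n.+1.
Proof.
apply/subsetP => v /setIdP[/preannihP vD /allP vL].
rewrite inE; apply/asboolP => j f fr u s.
case: u => [|x u]; last exact: (vD [:: x] isT j f fr u s).
have [le_jn|lt_nj] := leqP j n.+1; last first.
  apply: ev_eq0 => w wf; have /allP/(_ _ wf)/eqP sw := rel_homog fr.
  by rewrite ext_out // !size_cat sw /=; lia.
have j_gt0 : (0 < j)%N by case: j fr {le_jn} => //; rewrite rel0.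
have /vL/eqP/= v0 : (j, f) \in rels_upto n.+1.
  by apply: allpairs_f_dep => //; rewrite mem_iota; lia.
have -> : ev (fun w => ext v ([::] ++ w ++ s)) f = contr f (ext v) s by [].
rewrite -(restrK (n := (n.+1 - j)%N)) ?v0 ?ext0 // => w.
exact: contr_supp (rel_homog fr) _.
Qed.

Lemma card_annih_deg_step n : (#|annih_deg n| ^ #|X|
   <= #|annih_deg n.+1|
      * \prod_(1 <= j < n.+2) #|annih_deg (n.+1 - j)| ^ size (rel j))%N.
Proof.
apply: leq_trans (card_killed (L := rels_upto n.+1) (fun _ => id)) _.
rewrite /rels_upto big_allpairs_dep /= leq_mul //.
  exact/subset_leq_card/killed_annih_deg.
rewrite /index_iota subSS subn0 leq_eqVlt; apply/orP; left; apply/eqP.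
by apply: eq_bigr => j _; rewrite big_const_seq count_predT iter_muln_1.
Qed.

Lemma card_annih_deg0 : #|annih_deg 0| = 2%N.
Proof.
have -> : annih_deg 0 = setT.
  apply/setP => v; rewrite !inE; apply/asboolP => j f fr u s.
  have j0 : j != 0%N by apply: contraTneq fr => ->; rewrite rel0.
  apply: ev_eq0 => w wf; have /allP/(_ _ wf)/eqP sw := rel_homog fr.
  by rewrite ext_out // !size_cat sw; lia.
by rewrite cardsT card_ffun card_tuple expn0 expn1 card_Fp.
Qed.

Lemma card_annih_deg_gt0 n : (0 < #|annih_deg n|)%N.
Proof.
apply/card_gt0P; exists 0; rewrite inE; apply/asboolP.
by apply: eq_annih annih0 => w; rewrite ext0.
Qed.

End Annihilator.

(** By induction [c (n - i) ^ (q ^ i) <= c n], so after raising to the power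
[q ^ n] the product in the recurrence is at most [c n] to a power which the
smallness hypothesis bounds by [q ^ n.+1]; thus the product itself is at most
[c n ^ q], and it can be cancelled from [c n ^ (q * 2)]. *)
Lemma growth_of_recurrence (c r : nat -> nat) (q : nat) :
  (0 < q)%N -> (forall n, 0 < c n)%N ->
  (forall n, c n ^ (q * 2)
     <= c n.+1 * \prod_(1 <= j < n.+2) c (n.+1 - j) ^ r j)%N ->
  (forall n, \sum_(1 <= j < n.+1) r j * q ^ (n - j) <= q ^ n)%N ->
  forall n, (c n ^ q <= c n.+1)%N.
Proof.
move=> q_gt0 c_gt0 rec small; elim/ltn_ind => n IH.
have iterIH i : (i <= n)%N -> (c (n - i) ^ (q ^ i) <= c n)%N.
  elim: i => [|i IHi] lt_in; first by rewrite subn0 expn1.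
  apply: leq_trans (IHi (ltnW lt_in)); rewrite expnS expnM.
  rewrite leq_exp2r ?expn_gt0 ?q_gt0 // -(subnSK lt_in).
  by apply: IH; lia.
have prod_le : (\prod_(1 <= j < n.+2) c (n.+1 - j) ^ r j <= c n ^ q)%N.
  have qn_gt0 : (0 < q ^ n)%N by rewrite expn_gt0 q_gt0.
  rewrite -(leq_exp2r _ _ qn_gt0) -expnM -expnS.
  apply: leq_trans (leq_pexp2l (c_gt0 n) (small n.+1)).
  rewrite expn_sum.
  rewrite (big_morph (fun x => x ^ (q ^ n))%N (id1 := 1%N) (op1 := muln));
    [|by move=> x y; rewrite expnMn | by rewrite exp1n].
  rewrite big_nat_cond [leqRHS]big_nat_cond; apply: leq_prod => j.
  rewrite andbT => /andP[j_gt0 lt_j].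
  have -> : ((c (n.+1 - j) ^ r j) ^ (q ^ n)
             = (c (n - j.-1) ^ (q ^ j.-1)) ^ (r j * q ^ (n.+1 - j)))%N.
    have -> : (n - j.-1 = n.+1 - j)%N by lia.
    rewrite -!expnM mulnCA; congr (_ ^ (_ * _))%N.
    rewrite -expnD; congr (_ ^ _)%N; lia.
  case: (posnP (r j * q ^ (n.+1 - j))) => [->|pos]; first by rewrite !expn0.
  by rewrite leq_exp2r // iterIH; lia.
have := leq_trans (rec n) (leq_mul (leqnn _) prod_le).
by rewrite muln2 -addnn expnD leq_pmul2r // expn_gt0 c_gt0.
Qed.

(** The Golod-Shafarevich theorem for [q * 2] letters, in dual form: if the
numbers of relations of each degree, weighted by [q ^ - j], add up to at most
one, then the dimensions of the components of the quotient at least multiply by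
[q] at each step, starting from dimension one in degree zero; so none of them
vanishes. *)
Lemma annih_deg_nontrivial (X : finType) (rel : nat -> seq (seq (seq X)))
    (q : nat) :
  (forall j f, f \in rel j -> homog j f) -> rel 0 = [::] ->
  (0 < q)%N -> #|X| = (q * 2)%N ->
  (forall n, \sum_(1 <= j < n.+1) size (rel j) * q ^ (n - j) <= q ^ n)%N ->
  forall n, exists2 phi, annih rel phi & exists2 w, size w = n & phi w != 0.
Proof.
move=> rel_homog rel0 q_gt0 cardX small n.
have c_gt0 := card_annih_deg_gt0 rel.
have grow := growth_of_recurrence q_gt0 c_gt0 _ small.
have c_gt1 : (1 < #|annih_deg rel n|)%N.
  elim: n => [|n IH]; first by rewrite card_annih_deg0.
  apply: leq_trans (grow _ n); last first.
    by move=> m; rewrite -cardX; apply: card_annih_deg_step.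
  by apply: leq_trans IH _; rewrite -{1}[#|_|]expn1 leq_pexp2l // ltnW.
have [v vW v0] : exists2 v, v \in annih_deg rel n & v != 0.
  apply/exists_inP; apply: contraLR c_gt1 => /exists_inPn none.
  rewrite -leqNgt.
  apply: leq_trans (eq_leq (cards1 (0 : {ffun n.-tuple X -> 'F_2}))).
  apply/subset_leq_card/subsetP => v /none; rewrite inE; exact: negbNE.
exists (ext v); first by move: vW; rewrite inE => /asboolP.
have [t vt] : exists t, v t != 0.
  apply/existsP; apply: contraNT v0 => /existsPn none.
  by apply/eqP/ffunP => t; rewrite ffunE; apply/eqP/negbNE/none.
by exists (tval t); rewrite ?size_tuple // extE.
Qed.

(** * The quotient algebra *)

Section Quotient.
Variables (X : finType) (rel : nat -> seq (seq (seq X))).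
Implicit Types (a b : seq (seq X)).

Definition coord a (phi : sig (annih rel)) : ('F_2)^o := ev (sval phi) a.

Lemma coord_eqP a b :
  coord a = coord b <-> forall phi, annih rel phi -> ev phi a = ev phi b.
Proof.
split=> [eqab phi Wphi|eqab].
  exact: (congr1 (fun f => f (exist _ phi Wphi)) eqab).
by apply/funext => -[phi Wphi]; apply: eqab.
Qed.

Lemma coord_nil : coord [::] = 0.
Proof. by apply/funext => phi; apply: ev_nil. Qed.

Lemma coord_cat a b : coord (a ++ b) = coord a + coord b.
Proof. by apply/funext => phi; apply: ev_cat. Qed.

(** The polynomials that vanish under all annihilating functionals form a
two-sided ideal, because translates of annihilating functionals annihilate. *)
Lemma coord_mul a a' b b' : coord a = coord a' -> coord b = coord b' ->
  coord (mulp a b) = coord (mulp a' b').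
Proof.
move=> /coord_eqP eqa /coord_eqP eqb; apply/coord_eqP => phi Wphi.
transitivity (ev phi (mulp a b')).
  rewrite !ev_mulpl; apply: eq_bigr => u _.
  by apply: eqb; apply: annih_shiftl.
by rewrite !ev_mulpr; apply: eq_bigr => v _; apply/eqa/annih_shiftr.
Qed.

Definition is_coord : {pred sig (annih rel) -> ('F_2)^o} :=
  [pred f | `[< exists2 a, posp a & f = coord a >]].

Lemma is_coordP f :
  reflect (exists2 a, posp a & f = coord a) (f \in is_coord).
Proof. exact: asboolP. Qed.

Lemma is_coord_submod : submod_closed is_coord.
Proof.
split=> [|c _ _ /is_coordP[a pa ->] /is_coordP[b pb ->]]; apply/is_coordP.
  by exists [::]; rewrite ?coord_nil.
case: (F2_cases c) => ->; first by exists b; rewrite // scale0r add0r.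
by exists (a ++ b); rewrite ?posp_cat ?pa // scale1r coord_cat.
Qed.

HB.instance Definition _ := GRing.isSubmodClosed.Build _ _ is_coord
  is_coord_submod.

(** The quotient by an ideal of the algebra of polynomials without constant
term, realised inside the bidual: equality of classes is equality of functions,
and the vector space structure is inherited from a function space. *)
Record quo : Type := Quo { quo_val; _ : quo_val \in is_coord }.

HB.instance Definition _ := [isSub for quo_val].
HB.instance Definition _ := [Choice of quo by <:].
HB.instance Definition _ := [SubChoice_isSubLmodule of quo by <:].

(** The class of a polynomial; it is 0 by default if the empty word occurs. *)
Definition cls a : quo := insubd 0 (coord a).

Lemma val_cls a : posp a -> val (cls a) = coord a.
Proof. by move=> pa; apply: insubdK; apply/is_coordP; exists a. Qed.

Lemma cls_ex (x : quo) : exists a, posp a && (x == cls a).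
Proof.
have /is_coordP[a pa eqa] := valP x; exists a; rewrite pa.
by apply/eqP/val_inj; rewrite val_cls.
Qed.

Definition rep (x : quo) : seq (seq X) := xchoose (cls_ex x).

Lemma posp_rep x : posp (rep x).
Proof. by have /andP[] := xchooseP (cls_ex x). Qed.

Lemma repK : cancel rep cls.
Proof. by move=> x; have /andP[_ /eqP] := xchooseP (cls_ex x). Qed.

Lemma coord_rep a : posp a -> coord (rep (cls a)) = coord a.
Proof. by move=> pa; rewrite -val_cls ?posp_rep // repK val_cls. Qed.

Lemma clsP x : {a | posp a & x = cls a}.
Proof. by exists (rep x); rewrite ?posp_rep ?repK. Qed.

Lemma eq_cls a b : posp a -> posp b ->
  (forall phi, annih rel phi -> ev phi a = ev phi b) -> cls a = cls b.
Proof. by move=> pa pb /coord_eqP eqab; apply: val_inj; rewrite !val_cls. Qed.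

Lemma cls_nil : cls [::] = 0.
Proof. by apply: val_inj; rewrite val_cls // coord_nil. Qed.

Lemma cls_cat a b : posp a -> posp b -> cls (a ++ b) = cls a + cls b.
Proof.
move=> pa pb; apply: val_inj.
by rewrite raddfD /= !val_cls ?posp_cat ?pa // coord_cat.
Qed.

Definition quo_mul (x y : quo) : quo := cls (mulp (rep x) (rep y)).

Lemma cls_mul a b : posp a -> posp b ->
  quo_mul (cls a) (cls b) = cls (mulp a b).
Proof.
move=> pa pb; apply: val_inj; rewrite !val_cls ?posp_mul ?posp_rep //.
by apply: coord_mul; rewrite coord_rep.
Qed.

Lemma quo_mulA : associative quo_mul.
Proof.
move=> x y z.
case: (clsP x) (clsP y) (clsP z) => [a pa ->] [b pb ->] [c pc ->].
rewrite !cls_mul ?posp_mul //; apply: eq_cls; rewrite ?posp_mul // => phi _.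
exact: ev_mulpA.
Qed.

Lemma quo_mulDl : left_distributive quo_mul +%R.
Proof.
move=> x y z.
case: (clsP x) (clsP y) (clsP z) => [a pa ->] [b pb ->] [c pc ->].
rewrite -cls_cat // !cls_mul ?posp_cat ?pa // -cls_cat ?posp_mul //.
by rewrite mulp_catl.
Qed.

Lemma quo_mulDr : right_distributive quo_mul +%R.
Proof.
move=> x y z.
case: (clsP x) (clsP y) (clsP z) => [a pa ->] [b pb ->] [c pc ->].
rewrite -cls_cat // !cls_mul ?posp_cat ?pb // -cls_cat ?posp_mul //.
apply: eq_cls; rewrite ?posp_cat ?posp_mul // => phi _.
by rewrite ev_cat !ev_mulpr /= big_cat.
Qed.

Lemma quo_mul0l x : quo_mul 0 x = 0.
Proof. by apply: (addIr (quo_mul 0 x)); rewrite -quo_mulDl !add0r. Qed.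

Lemma quo_mul0r x : quo_mul x 0 = 0.
Proof. by apply: (addIr (quo_mul x 0)); rewrite -quo_mulDr !add0r. Qed.

Lemma quo_mulZl c x y : quo_mul (c *: x) y = c *: quo_mul x y.
Proof. by case: (F2_cases c) => ->; rewrite ?scale1r ?scale0r ?quo_mul0l. Qed.

Lemma quo_mulZr c x y : quo_mul x (c *: y) = c *: quo_mul x y.
Proof. by case: (F2_cases c) => ->; rewrite ?scale1r ?scale0r ?quo_mul0r. Qed.

HB.instance Definition _ := Lmodule_isNUAlgebra.Build ('F_2) quo
  quo_mulA quo_mulDl quo_mulDr quo_mulZl quo_mulZr.

Lemma clsM a b : posp a -> posp b -> cls a ** cls b = cls (mulp a b).
Proof. exact: cls_mul. Qed.

Lemma quo_addxx (x : quo) : x + x = 0.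
Proof. by rewrite -[x]scale1r -scalerDl F2_addxx scale0r. Qed.

Lemma cls_sum a : posp a -> cls a = \sum_(w <- a) cls [:: w].
Proof.
elim: a => [_|w a IH]; first by rewrite cls_nil big_nil.
rewrite -cat1s posp_cat => /andP[pw pa].
by rewrite cls_cat // big_cat big_seq1 IH.
Qed.

Lemma quo_fg : finitely_generated quo.
Proof.
exists [seq cls [:: [:: x]] | x <- enum X] => A [[A0 AD] AM] sA.
have Ax x : cls [:: [:: x]] \in A.
  by apply: sA; apply/mapP; exists x; rewrite ?mem_enum.
have Aw w : w != [::] -> cls [:: w] \in A.
  elim: w => // x [|y w] IH _; first exact: Ax.
  have -> : [:: x, y & w] = [:: x] ++ y :: w by [].
  rewrite -[[:: _ ++ _]]/(mulp [:: [:: x]] [:: y :: w]) -clsM //.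
  by apply: AM; [apply: Ax | apply: IH].
move=> x; case: (clsP x) => {x} a pa ->; rewrite cls_sum // big_seq.
apply: (big_ind (fun x => x \in A)) => // [x y xA yA|w wa].
  by rewrite -[x]scale1r AD.
by apply: Aw; apply: (pospP _ pa).
Qed.

Hypothesis rel_homog : forall j f, f \in rel j -> homog j f.

Definition evq (phi : sig (annih rel)) (x : quo) : 'F_2 := val x phi.

Lemma evq_cls phi a : posp a -> evq phi (cls a) = ev (sval phi) a.
Proof. by move=> pa; rewrite /evq val_cls. Qed.

Lemma evq_sum phi (I : Type) (r : seq I) (f : I -> quo) :
  evq phi (\sum_(i <- r) f i) = \sum_(i <- r) evq phi (f i).
Proof.
by apply: (big_morph (evq phi)) => [x y|]; rewrite /evq ?raddfD ?raddf0.
Qed.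

Lemma evq_eq x y : (forall phi, evq phi x = evq phi y) -> x = y.
Proof. by move=> eqxy; apply/val_inj/funext. Qed.

Definition hpart n : {pred quo} :=
  [pred x | `[< exists2 a, homog n a & x = cls a >]].

Lemma hpartP n x : reflect (exists2 a, homog n a & x = cls a) (x \in hpart n).
Proof. exact: asboolP. Qed.

(** Uniqueness of homogeneous components holds because annihilating functionals
may be truncated to a single degree, where they see one component only. *)
Lemma quo_grading : grading hpart.
Proof.
split=> [n n0|x|m c cV c0 n /andP[n0 lt_nm]|i j i0 j0 x y].
- split=> [|k _ _ /hpartP[a ha ->] /hpartP[b hb ->]]; apply/hpartP.
    by exists [::]; rewrite ?cls_nil.
  case: (F2_cases k) => ->; first by exists b; rewrite // scale0r add0r.
  exists (a ++ b); first by rewrite /homog all_cat; apply/andP; split.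
  by rewrite scale1r cls_cat ?(homog_posp n0).
- case: (clsP x) => {x} a pa ->.
  exists (\max_(u <- a) size u).+1, (fun n => cls (part n a)); split.
    by move=> n n0; apply/hpartP; exists (part n a); rewrite ?part_homog.
  apply: evq_eq => phi; rewrite evq_sum evq_cls //.
  rewrite (@sum_part _ _ _ (\max_(u <- a) size u).+1); last first.
    move=> w wa; rewrite size_lt_bound // andbT lt0n size_eq0.
    exact: (pospP _ pa).
  by apply: eq_bigr => n _; rewrite evq_cls // posp_part.
- have /hpartP[a ha eqa] := cV n n0; rewrite eqa; apply: evq_eq => -[phi Wphi].
  have Wtr := annih_trunc rel_homog (pred1 n) Wphi.
  rewrite evq_cls ?(homog_posp n0) //= -(ev_trunc_homog phi ha).
  have := congr1 (evq (exist _ _ Wtr)) c0.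
  rewrite evq_sum (bigD1_seq n) ?mem_index_iota ?n0 ?iota_uniq //=.
  rewrite eqa evq_cls ?(homog_posp n0) //= big1_seq ?addr0 // => i.
  rewrite mem_index_iota => /andP[i_n /andP[i0 _]].
  have /hpartP[b hb ->] := cV i i0.
  rewrite evq_cls ?(homog_posp i0) //=; exact: ev_trunc_other hb i_n.
- move=> /hpartP[a ha ->] /hpartP[b hb ->]; apply/hpartP.
  exists (mulp a b); last first.
    by rewrite (clsM (homog_posp i0 ha) (homog_posp j0 hb)).
  apply/allP => _ /allpairsPdep[u [v [ua vb ->]]].
  by rewrite size_cat (eqP (allP ha _ ua)) (eqP (allP hb _ vb)).
Qed.

(** Finitely many classes have representatives of bounded degree, so a
functional supported in a larger degree vanishes on their span. *)
Lemma quo_infinite :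
  (forall n, exists2 phi, annih rel phi & exists2 w, size w = n & phi w != 0) ->
  infinite_dimensional quo.
Proof.
move=> big [n [e e_span]].
pose m := (\max_(i < n) \max_(u <- rep (e i)) size u).+1.
have [phi Wphi [w sw phiw]] := big m.
have Wtr := annih_trunc rel_homog (pred1 m) Wphi.
pose psi : sig (annih rel) := exist _ _ Wtr.
have psi_e i : evq psi (e i) = 0.
  rewrite -[e i]repK evq_cls ?posp_rep //=.
  apply: ev_eq0 => u /size_lt_bound lt_u; rewrite /trunc /= ltn_eqF //.
  apply: leq_trans lt_u _; rewrite ltnS.
  exact: (leq_bigmax_cond (F := fun i => \max_(u <- rep (e i)) size u)).
have w0 : posp [:: w] by apply/pospP => u /[!inE] /eqP ->; case: w sw {phiw}.
have [c cE] := e_span (cls [:: w]).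
have := congr1 (evq psi) cE; rewrite evq_cls // ev1 /= /trunc /= sw eqxx.
rewrite evq_sum big1 => [phi0|i _]; first by rewrite phi0 eqxx in phiw.
by case: (F2_cases (c i)) => ->; rewrite ?scale1r ?psi_e // scale0r /evq raddf0.
Qed.

End Quotient.

(** * Powers, and factorisation modulo high degree *)

Section LowDegree.
Variable X : finType.
Implicit Types (a b d s t : seq (seq X)) (phi : seq X -> 'F_2).

(** Cancellation in pairs is allowed, so [t] may well contain short words. *)
Definition vanish_upto M t :=
  forall phi, (forall w, (M < size w)%N -> phi w = 0) -> ev phi t = 0.

(** The power [a ^ n], for positive [n]. *)
Definition mpow a n := iter n.-1 (mulp a) a.

Lemma posp_mpow a n : posp a -> posp (mpow a n).
Proof.
by case: n => [|n] // pa; rewrite /mpow /=; case: n => //= n; apply: posp_mul.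
Qed.

Lemma size_mpow a n w :
  (0 < n)%N -> posp a -> w \in mpow a n -> (n <= size w)%N.
Proof.
case: n => // n _ pa; rewrite /mpow /=.
elim: n w => [|n IHn] w; first by move=> /(pospP _ pa); case: w.
move=> /allpairsPdep[u [v [ua /IHn nv ->]]].
rewrite size_cat; have := pospP _ pa _ ua; case: u {ua} => //= x u _; lia.
Qed.

Lemma mpow_vanish a M : posp a -> vanish_upto M (mpow a M.+1).
Proof.
move=> pa phi supp; apply: ev_eq0 => w.
by move=> /(size_mpow (ltn0Sn _) pa); apply: supp.
Qed.

(** This is (1 + w_1) ... (1 + w_m) - 1, the product of the words of the list in
the adjoint group. *)
Fixpoint circ_prod s : seq (seq X) :=
  if s is w :: s' then
    w :: circ_prod s' ++ mulp [:: w] (circ_prod s')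
  else [::].

Lemma posp_circ_prod s : posp s -> posp (circ_prod s).
Proof.
elim: s => // w s IH; rewrite [circ_prod _]/= !posp_cons => /andP[w0 ps].
by rewrite posp_cat w0 IH ?posp_mul // /posp inE eq_sym.
Qed.

(** At each step the error of the previous factorisation is, over the field with
two elements, the sum [a ++ circ_prod s]; the words of its lowest remaining
degree become new factors. *)
Fixpoint factors M a : seq (seq X) :=
  if M is M'.+1 then
    let s := factors M' a in part M (a ++ circ_prod s) ++ s
  else [::].

Lemma posp_factors M a : posp a -> posp (factors M a).
Proof.
move=> pa; elim: M => //= M IH.
by rewrite posp_cat IH andbT posp_part // posp_cat pa posp_circ_prod.
Qed.

(** Factors 1 + v with [v] of the top degree [M] act additively up to degree
[M]: a product of [v] with any nonempty word is longer than [M]. *)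
Lemma ev_circ_prod_homog M phi d s :
  (forall w, (M < size w)%N -> phi w = 0) -> homog M d -> posp d -> posp s ->
  ev phi (circ_prod (d ++ s)) = ev phi d + ev phi (circ_prod s).
Proof.
move=> supp; elim: d => [|w d IH] hd pd ps; first by rewrite ev_nil add0r.
move: hd pd => /= /andP[/eqP sw hd]; rewrite posp_cons => /andP[_ pd].
have pds : posp (circ_prod (d ++ s)) by rewrite posp_circ_prod // posp_cat pd.
have tail0 : ev (fun v => phi (w ++ v)) (circ_prod (d ++ s)) = 0.
  apply: ev_eq0 => u uds; apply: supp; rewrite size_cat sw.
  by have := pospP _ pds u uds; case: u {uds} => //= x u _; lia.
by rewrite !ev_cons ev_cat IH // ev_mulpl big_seq1 tail0 addr0 addrA.
Qed.

Lemma factors_vanish M a : posp a ->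
  vanish_upto M (a ++ circ_prod (factors M a)).
Proof.
move=> pa; elim: M => [|M IH] phi supp.
  rewrite cats0; apply: ev_eq0 => w /(pospP _ pa) w0.
  by apply: supp; rewrite lt0n size_eq0.
rewrite [factors _ _]/=; set s := factors M a in IH *.
have ps : posp s by apply: posp_factors.
set b := a ++ circ_prod s in IH *.
have pb : posp b by rewrite posp_cat pa posp_circ_prod.
rewrite ev_cat (ev_circ_prod_homog supp (part_homog _ _)) ?posp_part //.
rewrite addrCA -ev_cat -/b ev_part.
(* The new factors cancel the component of the old error [b] of degree M + 1;
   what is left of [phi] on [b] is supported in degrees <= M. *)
have -> : ev phi b = ev (trunc (pred1 M.+1) phi) b
  + ev (fun w => phi w - trunc (pred1 M.+1) phi w) b by rewrite evB addrC subrK.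
rewrite addrA F2_addxx add0r; apply: IH => w lt_w; rewrite /trunc /=.
by case: eqP => [_|ne]; rewrite ?subrr // subr0 supp //; lia.
Qed.

End LowDegree.

(** * The relations *)

(** The number of relations of degree [j] in [rels] below, over four letters. *)
Definition nrel (j : nat) : nat :=
  ((j - 8) * 2 + (if (8 %| j) && (0 < j) then 4 ^ (j %/ 8) else 0))%N.

(** With [S n] for the sum, [S n.+1 = 2 * S n + nrel n.+1].  From degree 8 on, the
term [2 * n + 4] absorbs the linear part of [nrel] and the power of 2 absorbs
the exponential part, which is [2 ^ (n - 6 * (n / 8))] if 8 divides [n]. *)
Lemma nrel_small n : (\sum_(1 <= j < n.+1) nrel j * 2 ^ (n - j) <= 2 ^ n)%N.
Proof.
pose S n := (\sum_(1 <= j < n.+1) nrel j * 2 ^ (n - j))%N; rewrite -/(S n).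
have SS m : S m.+1 = (S m * 2 + nrel m.+1)%N.
  rewrite /S big_nat_recr //= subnn muln1; congr (_ + _)%N.
  rewrite big_distrl /=; apply: eq_big_nat => j /andP[_ lt_j].
  by rewrite -mulnA -expnSr subSn.
have S0 m : (m < 8)%N -> S m = 0%N.
  elim: m => [|m IH] lt_m; first by rewrite /S big_geq.
  rewrite SS IH ?(ltnW lt_m) // /nrel.
  by case: ifP => [/andP[d8 _]|_]; lia.
have main m : (S (m + 8) + (m + 8) * 2 + 4
    + 2 ^ ((m + 8) - 6 * ((m + 8) %/ 8)) <= 2 ^ (m + 8))%N.
  elim: m => [|m]; first by rewrite SS S0.
  rewrite addSn; move: (m + 8)%N (leq_addl m 8) => {m} m m_ge8 IH.
  rewrite SS /nrel; have [d8|nd8] /= := boolP (8 %| m.+1)%N.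
    have /dvdnP[q mE] := d8; rewrite mE mulnK //.
    have q_gt0 : (0 < q)%N by lia.
    have mq : (m %/ 8 = q.-1)%N by lia.
    rewrite mq in IH.
    have e1 : (q * 8 - 6 * q = 2 * q)%N by lia.
    have e2 : (m - 6 * q.-1 = 2 * q + 5)%N by lia.
    rewrite e1 -mE expnS -[(4 ^ q)%N]/((2 ^ 2) ^ q)%N -expnM.
    rewrite e2 expnD in IH.
    by move: (2 ^ (2 * q))%N (2 ^ m)%N IH => P Q; lia.
  have mq : (m.+1 %/ 8 = m %/ 8)%N by lia.
  have -> : (m.+1 - 6 * (m.+1 %/ 8) = (m - 6 * (m %/ 8)).+1)%N by lia.
  rewrite !expnS; lia.
have [lt_n8|ge_n8] := ltnP n 8; first by rewrite S0.
by have := main (n - 8)%N; rewrite subnK //; lia.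
Qed.

Section Construction.
Variable X : finType.

Definition polyn k : seq (seq X) :=
  [seq w <- odflt [::] (unpickle k) | w != [::]].

Lemma posp_polyn k : posp (polyn k).
Proof. by rewrite /posp mem_filter eqxx. Qed.

Lemma polyn_pickle a : posp a -> polyn (pickle a) = a.
Proof.
move=> pa; rewrite /polyn pickleK /=; apply/all_filterP/allP.
exact: (pospP _ pa).
Qed.

Definition nil_task k := mpow (polyn k) (k + 8).+1.

Definition gen_task k := polyn k ++ circ_prod (factors (k + 8) (polyn k)).

Definition wpow8 (w : seq X) : seq X := w ++ w ++ w ++ w ++ w ++ w ++ w ++ w.

(** The tasks with index [k] only contribute to the degrees [j > k + 8].  Their
components of lower degree are zero polynomials already, so nothing is lost, and
few relations of each degree remain. *)
Definition rels (j : nat) : seq (seq (seq X)) :=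
  [seq part j (nil_task k) | k <- iota 0 (j - 8)]
  ++ [seq part j (gen_task k) | k <- iota 0 (j - 8)]
  ++ (if (8 %| j)%N && (0 < j)%N then
        [seq [:: wpow8 (tval t)] | t : (j %/ 8)%N.-tuple X]
      else [::]).

Lemma rels_homog j f : f \in rels j -> homog j f.
Proof.
rewrite !mem_cat => /or3P[/mapP[k _ ->]|/mapP[k _ ->]|].
- exact: part_homog.
- exact: part_homog.
case: ifP => // /andP[d8 _] /mapP[t _ ->].
by rewrite /homog /= andbT !size_cat size_tuple; apply/eqP; lia.
Qed.

Lemma size_rels j : #|X| = 4%N -> size (rels j) = nrel j.
Proof.
move=> cardX; rewrite !size_cat !size_map !size_iota /nrel; case: ifP => _ /=.
  by rewrite size_map -cardE card_tuple cardX; lia.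
by lia.
Qed.

Lemma annih_wpow8 phi w : w != [::] -> annih rels phi -> phi (wpow8 w) = 0.
Proof.
move=> w0 Wphi; have := Wphi (8 * size w)%N [:: wpow8 w] _ [::] [::].
rewrite ev1 /= cats0; apply; rewrite !mem_cat; apply/or3P/Or33.
rewrite dvdn_mulr // muln_gt0 andTb [(0 < size w)%N]lt0n size_eq0 w0.
apply/mapP.
have sw : size w == (8 * size w %/ 8)%N by rewrite mulKn.
by exists (Tuple sw); rewrite ?mem_enum.
Qed.

(** The components of [t] of degree at most [k + 8] are zero, as one sees by
testing [t] on truncated functionals, and the others are relations. *)
Lemma annih_task phi k t : annih rels phi -> posp t ->
  vanish_upto (k + 8) t ->
  (forall j, (k + 8 < j)%N -> part j t \in rels j) -> ev phi t = 0.
Proof.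
move=> Wphi pt low high.
rewrite (@sum_part _ phi t (\max_(u <- t) size u).+1); last first.
  by move=> w wt; rewrite size_lt_bound // andbT lt0n size_eq0 (pospP _ pt).
apply: big1_seq => n _; have [le_n|lt_n] := leqP n (k + 8).
  rewrite ev_part low // => w lt_w; rewrite /trunc /=; case: eqP => // sw; lia.
rewrite -[RHS](Wphi n _ (high n lt_n) [::] [::]).
by apply: eq_ev => w _ /=; rewrite cats0.
Qed.

Lemma annih_nil_task phi k : annih rels phi -> ev phi (nil_task k) = 0.
Proof.
have pk := posp_polyn k.
move=> Wphi; apply: (annih_task (k := k)) => //; first exact: posp_mpow.
  exact: mpow_vanish.
move=> j lt_j; rewrite !mem_cat; apply/or3P/Or31/mapP.
by exists k; rewrite // mem_iota; lia.
Qed.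

Lemma annih_gen_task phi k : annih rels phi -> ev phi (gen_task k) = 0.
Proof.
have pk := posp_polyn k.
move=> Wphi; apply: (annih_task (k := k)) => //.
- by rewrite posp_cat pk posp_circ_prod // posp_factors.
- exact: factors_vanish.
move=> j lt_j; rewrite !mem_cat; apply/or3P/Or32/mapP.
by exists k; rewrite // mem_iota; lia.
Qed.

(** * The adjoint group of the quotient *)

Local Notation R := (quo rels).

Lemma nuexp_cls a n :
  posp a -> nuexp (cls rels a) n.+1 = cls rels (mpow a n.+1).
Proof.
move=> pa; elim: n => // n IH.
by rewrite nuexpS // IH clsM ?posp_mpow.
Qed.

Lemma quo_nil : nil_algebra R.
Proof.
move=> x; case: (clsP x) => {x} a pa ->.
exists (pickle a + 8).+1; split=> //; rewrite nuexp_cls // -cls_nil.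
apply: eq_cls => //; first exact: posp_mpow.
move=> phi Wphi; rewrite ev_nil -(annih_nil_task (pickle a) Wphi).
by rewrite /nil_task polyn_pickle.
Qed.

Local Notation G := (adjoint quo_nil).

(** (1 + x)^2 = 1 + x^2 in characteristic 2; three squarings give the exponent
8 of the generators. *)
Lemma adjoint_sqr (x : G) : (x ^+ 2)%g = (x : R) ** (x : R).
Proof. by rewrite expgS expg1 adjointM quo_addxx add0r. Qed.

Definition word_gen : {pred G} :=
  [pred x : G | `[< exists2 w, w != [::] & x = cls rels [:: w] >]].

Lemma word_genP (x : G) :
  reflect (exists2 w, w != [::] & x = cls rels [:: w]) (x \in word_gen).
Proof. exact: asboolP. Qed.

Lemma word_gen_exp8 x : x \in word_gen -> (x ^+ 8 = 1)%g.
Proof.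
move=> /word_genP[w w0 ->].
have pw u : u != [::] -> posp [:: u] by rewrite posp_cons => ->.
have ww u : u != [::] -> u ++ u != [::] by case: u.
have sq u : u != [::] ->
    ((cls rels [:: u] : G) ^+ 2)%g = cls rels [:: u ++ u] :> R.
  by move=> u0; rewrite adjoint_sqr clsM ?pw.
rewrite -[8%N]/(2 * 2 * 2)%N !expgnA !sq ?ww //.
rewrite adjoint1 -cls_nil; apply: eq_cls; rewrite ?pw ?ww // => phi Wphi.
by rewrite ev1 ev_nil -(annih_wpow8 w0 Wphi) /wpow8 -!catA.
Qed.

Lemma circ_prod_generated (H : {pred G}) s : group_closed H ->
  {subset word_gen <= H} -> posp s -> (cls rels (circ_prod s) : G) \in H.
Proof.
move=> Hgr sH; have H1 := Hgr.1; have HM := group_closedM Hgr.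
elim: s => [_|w s IH]; first by rewrite cls_nil.
rewrite posp_cons => /andP[w0 ps].
have pw : posp [:: w] by rewrite posp_cons w0.
have pc := posp_circ_prod ps.
have -> : cls rels (circ_prod (w :: s))
    = ((cls rels [:: w] : G) * (cls rels (circ_prod s) : G))%g :> G.
  have pm : posp (mulp [:: w] (circ_prod s)) by apply: posp_mul.
  by rewrite adjointM clsM // -!cls_cat // posp_cat pw.
by apply: HM (IH ps); apply/sH/word_genP; exists w.
Qed.

Lemma word_gen_generates : generates_group word_gen.
Proof.
move=> H Hgr sH x; case: (clsP (x : R)) => a pa ->.
have ps := posp_factors (pickle a + 8) pa.
have pc := posp_circ_prod ps.
suff -> : cls rels a = cls rels (circ_prod (factors (pickle a + 8) a)).
  exact: circ_prod_generated.
apply: eq_cls => // phi Wphi.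
have := annih_gen_task (pickle a) Wphi.
rewrite /gen_task polyn_pickle // ev_cat; move: (ev phi (circ_prod _)) => c.
by move=> /(congr1 (+%R^~ c)); rewrite -addrA F2_addxx addr0 add0r.
Qed.

End Construction.

Lemma has_order_le (G : groupType) (x : G) n : (0 < n)%N -> (x ^+ n = 1)%g ->
  exists m, (m <= n)%N /\ has_order x m.
Proof.
move=> n_gt0 /eqP xn.
have ex : exists m, (0 < m)%N && (x ^+ m == 1)%g by exists n; rewrite n_gt0.
case: (ex_minnP ex) => m /andP[m_gt0 /eqP xm] min_m; exists m; split.
  by apply: min_m; rewrite n_gt0.
split=> // k /andP[k_gt0 lt_k] /eqP xk.
by have := min_m k; rewrite k_gt0 xk leqNgt lt_k => /(_ isT).
Qed.

Theorem theorem3p2 :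
  exists (p : nat) (F : countFieldType) (R : nuAlgType F)
         (nilR : nil_algebra R),
    [/\ prime p /\ p \in [pchar F],
        finitely_generated R,
        graded R,
        infinite_dimensional R
      & exists (N : nat) (S : {pred adjoint nilR}),
          [/\ (0 < N)%N,
              generates_group S
            & {in S, forall x, exists n : nat, (n <= N)%N /\ has_order x n}]].
Proof.
exists 2%N, 'F_2, (quo (@rels 'I_4)), (@quo_nil 'I_4).
have homog_rels := @rels_homog 'I_4.
split.
- by split=> //; apply: pchar_Fp.
- exact: quo_fg.
- by exists (@hpart _ _); apply: quo_grading.
- apply: quo_infinite => //; apply: (annih_deg_nontrivial (q := 2)) => //.
    by rewrite card_ord.
  move=> n; apply: leq_trans (nrel_small n); apply: leq_sum => j _.
  by rewrite size_rels ?card_ord.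
- exists 8%N, (@word_gen 'I_4); split=> //; first exact: word_gen_generates.
  by move=> x /word_gen_exp8; apply: has_order_le.
Qed.
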